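(* Let $n,m\ge 2$ and let $\varphi$ be an endomorphism of $F_n\times F_m$. Then $\varphi$ is an automorphism if and only if one of the following holds: (i) $\varphi$ is of type VI and both component mappings $\phi$ and $\psi$ are automorphisms; (ii) $n=m$ and $\varphi$ is of type VII and both component mappings $\phi$ and $\psi$ are automorphisms.
   Context: $F_n,F_m$ are free groups of ranks $n,m$. Maps act on the right. An endomorphism $\varphi$ of $F_n\times F_m$ is of type VI if there are $\phi\in\mathrm{End}(F_n)$ and $\psi\in\mathrm{End}(F_m)$ (its component mappings) with $(x,y)\varphi=(x\phi,y\psi)$ for all $(x,y)$. It is of type VII if there are homomorphisms $\phi:F_n\to F_m$ and $\psi:F_m\to F_n$ (its component mappings) with $(x,y)\varphi=(y\psi,x\phi)$ for all $(x,y)$; when $n=m$ both groups are identified with the same free group $F_n$. *)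

(* Defs.v *)
From HB Require Import structures.
From mathcomp Require Import all_boot.

Set Implicit Arguments.
Unset Strict Implicit.
Unset Printing Implicit Defensive.

Import Monoid.Theory.
Local Open Scope group_scope.

(* The free group on an alphabet T, realised as the set of reduced words.     *)
(* The letter (t, false) stands for t and (t, true) for its formal inverse.   *)
Section FreeGroup.
Variable T : choiceType.
Implicit Types (a b : T * bool) (u v w : seq (T * bool)).

Definition letter_inv a : T * bool := (a.1, ~~ a.2).

Definition reduced w : bool := sorted (fun a b => b != letter_inv a) w.

(* The reduced form of a :: w, for w reduced. *)
Definition push a w : seq (T * bool) :=
  if w is b :: w' then (if b == letter_inv a then w' else a :: w) else [:: a].

(* The reduced form of u ++ v, for v reduced. *)
Definition word_mul u v : seq (T * bool) := foldr push v u.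

Definition word_inv u : seq (T * bool) := rev (map letter_inv u).

Lemma letter_invK : involutive letter_inv.
Proof. by case=> t s; rewrite /letter_inv /= negbK. Qed.

Lemma reduced_push a w : reduced w -> reduced (push a w).
Proof.
case: w => [|b w] //= rw; case: eqP => [_|/eqP nb].
  exact: path_sorted rw.
by rewrite /reduced /= nb.
Qed.

Lemma pushK a w : reduced w -> push a (push (letter_inv a) w) = w.
Proof.
case: w => [|b w] /=; first by rewrite eqxx.
rewrite letter_invK /reduced /=; case: eqP => [->|_] /=; last by rewrite eqxx.
by case: w => [|c w] //= /andP[/negbTE->].
Qed.

Lemma reduced_mul u v : reduced v -> reduced (word_mul u v).
Proof. by move=> rv; elim: u => //= a u; apply: reduced_push. Qed.

Lemma word_mul_push a u v :
  reduced v -> word_mul (push a u) v = push a (word_mul u v).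
Proof.
move=> rv; case: u => [|b u] //=; case: eqP => [->|//].
by rewrite pushK // reduced_mul.
Qed.

Lemma word_mulA u v w :
  reduced w -> word_mul u (word_mul v w) = word_mul (word_mul u v) w.
Proof. by move=> rw; elim: u => //= a u ->; rewrite word_mul_push. Qed.

Lemma word_muls1 u : reduced u -> word_mul u [::] = u.
Proof.
elim: u => //= a u IHu rau; rewrite IHu; last exact: path_sorted rau.
case: u rau {IHu} => [|b u] //=.
by rewrite /reduced /= => /andP[/negbTE->].
Qed.

Lemma word_invK : involutive word_inv.
Proof. by move=> u; rewrite /word_inv map_rev revK (mapK letter_invK). Qed.

Lemma reduced_inv u : reduced u -> reduced (word_inv u).
Proof.
rewrite /reduced /word_inv rev_sorted sorted_map.
apply: sub_sorted => a b /=; apply: contraNN => /eqP ->.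
by rewrite letter_invK.
Qed.

Lemma word_mulVs u : word_mul (word_inv u) u = [::].
Proof.
elim: u => // a u IHu.
by rewrite /word_mul /word_inv /= rev_cons foldr_rcons /= letter_invK eqxx.
Qed.

Record free_group : predArgType :=
  FreeGroup { fg_word : seq (T * bool); _ : reduced fg_word }.

HB.instance Definition _ := [isSub for fg_word].
HB.instance Definition _ := [Choice of free_group by <:].

Implicit Types x y z : free_group.

Definition fg_one : free_group := FreeGroup (isT : reduced [::]).
Definition fg_mul x y : free_group := FreeGroup (reduced_mul (fg_word x) (valP y)).
Definition fg_inv x : free_group := FreeGroup (reduced_inv (valP x)).

Lemma fg_mulA : associative fg_mul.
Proof. by move=> x y z; apply/val_inj/word_mulA/(valP z). Qed.

Lemma fg_mul1g : left_id fg_one fg_mul.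
Proof. by move=> x; apply/val_inj. Qed.

Lemma fg_mulg1 : right_id fg_one fg_mul.
Proof. by move=> x; apply/val_inj/word_muls1/(valP x). Qed.

Lemma fg_mulVg : left_inverse fg_one fg_inv fg_mul.
Proof. by move=> x; apply/val_inj/word_mulVs. Qed.

Lemma fg_mulgV : right_inverse fg_one fg_inv fg_mul.
Proof.
by move=> x; apply/val_inj; rewrite /= -{1}[fg_word x]word_invK word_mulVs.
Qed.

HB.instance Definition _ := isGroup.Build free_group
  fg_mulA fg_mul1g fg_mulg1 fg_mulVg fg_mulgV.

Definition fg_gen (t : T) : free_group := FreeGroup (isT : reduced [:: (t, false)]).

(* Universal property: every map from T to a group H extends uniquely to a    *)
(* group homomorphism on free_group.                                          *)
Section Lift.
Variables (H : groupType) (h : T -> H).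

Definition letter_val a : H := if a.2 then (h a.1)^-1 else h a.1.

Definition fg_lift x : H := foldr (fun a r => letter_val a * r) 1 (fg_word x).

Lemma letter_valV a : letter_val (letter_inv a) = (letter_val a)^-1.
Proof. by case: a => t [] /=; rewrite /letter_val /= ?invgK. Qed.

Fact fg_lift_is_morphism : {morph fg_lift : x y / x * y}.
Proof.
move=> [u ru] [v rv]; rewrite /fg_lift /=.
elim: u {ru} => [|a u IHu] /=; first by rewrite mul1g.
rewrite -mulgA -IHu; case: (word_mul u v) => [|b w] //=.
by case: eqP => [->|//]; rewrite letter_valV mulVKg.
Qed.

HB.instance Definition _ :=
  isMultiplicative.Build free_group H fg_lift fg_lift_is_morphism.

Lemma fg_lift_gen t : fg_lift (fg_gen t) = h t.
Proof. by rewrite /fg_lift /= mulg1. Qed.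

Lemma fg_lift_unique (f : free_group -> H) :
  {morph f : x y / x * y} -> (forall t, f (fg_gen t) = h t) -> f =1 fg_lift.
Proof.
move=> fM fh.
have f1 : f 1 = 1 by apply: (mulgI (f 1)); rewrite -fM !mulg1.
have fV x : f x^-1 = (f x)^-1.
  by apply: (mulgI (f x)); rewrite -fM !mulgV f1.
case=> u ru; rewrite /fg_lift /=; elim: u ru => [|[t s] u IHu] rau /=.
  by rewrite -[RHS]f1; congr f; apply: val_inj.
have ru : reduced u by exact: path_sorted rau.
pose g := if s then (fg_gen t)^-1 else fg_gen t.
have -> : FreeGroup rau = g * FreeGroup ru.
  apply: val_inj; rewrite /g; case: s rau {g} => rau /=;
    by case: u ru {IHu} rau => [|b u] //= _; rewrite /reduced /= => /andP[/negbTE->].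
by rewrite fM IHu /g /letter_val /=; case: s {rau g}; rewrite ?fV fh.
Qed.

End Lift.

End FreeGroup.

Definition free n : groupType := free_group 'I_n.

(* The identification of the two free groups when their ranks coincide. *)
Definition free_cast n m (e : n = m) (x : free n) : free m := ecast k (free k) e x.

Definition is_automorphism (G : groupType) (f : G -> G) : Prop :=
  {morph f : x y / x * y} /\ bijective f.

Definition type_VI_with (G H : groupType) (f : G * H -> G * H)
    (phi : {multiplicative G -> G}) (psi : {multiplicative H -> H}) : Prop :=
  forall x y, f (x, y) = (phi x, psi y).

Definition type_VII_with (G H : groupType) (f : G * H -> G * H)
    (phi : {multiplicative G -> H}) (psi : {multiplicative H -> G}) : Prop :=
  forall x y, f (x, y) = (psi y, phi x).

(* Main.v *)
From HB Require Import structures.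
Require Import Defs.
From mathcomp Require Import all_boot perm ssralg zmodp ssrint poly matrix.
From mathcomp Require Import ring zify.

(* In a free group, commutation is transitive on nontrivial elements. If f is a
   bijective endomorphism of F_n x F_m, then composing f with a projection gives
   commuting images of the two factors that together generate a nonabelian free
   group, so one of the two images is trivial. Injectivity leaves only the
   types VI and VII, and in the latter n = m because F_n and F_m are isomorphic.

   Transitivity is read off 2 x 2 matrices over Z[X]: a letter a acts as
   M_a = P_a - X P_(a^-1) where P_a is the rank one matrix with image (1, c_a)
   and kernel (1, c_(a^-1)), and M_a M_(a^-1) = - X. This is a projective
   representation in which no nontrivial element is scalar, because modulo X the
   product along a reduced word is nonzero of rank one; and the matrices
   commuting with a given nonscalar 2 x 2 matrix commute with each other. *)

Set Implicit Arguments.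
Unset Strict Implicit.
Unset Printing Implicit Defensive.

Import GRing.Theory.

(** * Commuting 2 x 2 matrices *)

Section TwoByTwo.
Local Open Scope ring_scope.

Definition mx2 (R : nzRingType) (a b c d : R) : 'M[R]_2 :=
  \matrix_(i, j) if i == 0 then (if j == 0 then a else b)
                 else (if j == 0 then c else d).

Lemma mx2M (R : nzRingType) (a b c d a' b' c' d' : R) :
  mx2 a b c d * mx2 a' b' c' d' =
  mx2 (a * a' + b * c') (a * b' + b * d') (c * a' + d * c') (c * b' + d * d').
Proof.
apply/matrixP=> i j; rewrite !mxE !big_ord_recl big_ord0 addr0 !mxE.
by case: ifP => _; case: ifP.
Qed.

Lemma mx2E (R : nzRingType) (A : 'M[R]_2) :
  A = mx2 (A 0 0) (A 0 1) (A 1 0) (A 1 1).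
Proof.
apply/matrixP=> i j; rewrite !mxE.
by case: i j => [[|[|[]]] //= ?] [[|[|[]]] //= ?]; congr (A _ _); apply: val_inj.
Qed.

(** Entries (0,0) and (0,1) of [A * B = B * A] suffice. Scaling by [A 0 1] clears the denominator in
    writing [B] as a linear polynomial in [A]. *)
Lemma comm_mx2_polyE (R : comNzRingType) (A B : 'M[R]_2) :
  A * B = B * A ->
  A 0 1 *: B = B 0 1 *: A + (A 0 1 * B 0 0 - B 0 1 * A 0 0)%:M.
Proof.
rewrite [A]mx2E [B]mx2E !mx2M => /matrixP AB.
have := (AB 0 0, AB 0 1); rewrite !mxE /= => -[e00 e01].
apply/matrixP=> i j; rewrite !mxE /=.
case: i j => [[|[|[]]] //= ?] [[|[|[]]] //= ?]; rewrite ?mulr1n ?mulr0n ?addr0.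
- by ring.
- by ring.
- by apply: (addrI (A 0 0 * B 0 0)); rewrite e00; ring.
- by apply: (addrI (A 0 0 * B 0 1)); rewrite addrC addrA e01; ring.
Qed.

(** After scaling by [A 0 1], both [B] and [C] are linear polynomials in [A], so they commute; the
    scalar cancels in a domain. *)
Lemma comm_mx2_trans (R : idomainType) (A B C : 'M[R]_2) :
  A 0 1 != 0 -> A * B = B * A -> A * C = C * A -> B * C = C * B.
Proof.
move=> nzA /comm_mx2_polyE EB /comm_mx2_polyE EC.
have inj (M N : 'M[R]_2) : A 0 1 *: M = A 0 1 *: N -> M = N.
  move=> /matrixP MN; apply/matrixP=> i j.
  by apply: (mulfI nzA); have := MN i j; rewrite !mxE.
apply/inj/inj.
have E : (A 0 1 *: B) * (A 0 1 *: C) = (A 0 1 *: C) * (A 0 1 *: B).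
  rewrite EB EC; apply: commrD; last exact: scalar_mxC.
  apply/commr_sym/commrD; last exact: scalar_mxC.
  by rewrite /GRing.comm -!scalerAl -!scalerAr !scalerA mulrC.
by rewrite -!scalerAl -!scalerAr in E.
Qed.
End TwoByTwo.

(** * A projective matrix representation of the free group *)

Section FreeGroupRepresentation.
Variable T : countType.
Local Open Scope ring_scope.

(** These are the constants c_a. Distinct letters get distinct integers, and a letter and its
    inverse get consecutive ones, so that their difference squares to 1. *)
Definition letter_point (a : T * bool) : {poly int} :=
  ((pickle a.1).*2 + a.2)%:R.

Definition letter_mx (a : T * bool) : 'M[{poly int}]_2 :=
  let c := letter_point a in let d := letter_point (letter_inv a) in
  mx2 ('X * c - d) (1 - 'X) ((- (c * d)) * (1 - 'X)) (c - 'X * d).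

Definition word_mx (u : seq (T * bool)) : 'M[{poly int}]_2 :=
  \prod_(a <- u) letter_mx a.

(** The image of each of P_a, P_(a^-1) is the kernel of the other, so only - X (P_a^2 + P_(a^-1)^2)
    survives, and this is the scalar - X (c - d)^2. *)
Lemma letter_mxV a : letter_mx a * letter_mx (letter_inv a) = (- 'X)%:M.
Proof.
rewrite /letter_mx letter_invK mx2M.
have: (letter_point a - letter_point (letter_inv a)) ^+ 2 = 1.
  by rewrite /letter_point; case: a => t [] /=; rewrite !natrD; ring.
move: (letter_point a) (letter_point (letter_inv a)) => c d cd.
(* Inserting this factor on the right turns every entry into an identity valid for all [c] and
   [d]. *)
have X : forall p : {poly int}, p = (c - d) ^+ 2 * p by move=> p; rewrite cd mul1r.
rewrite [in RHS](X (- 'X)).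
apply/matrixP=> i j; rewrite !mxE /=.
by case: i j => [[|[|[]]] //= ?] [[|[|[]]] //= ?]; rewrite /= ?mulr1n ?mulr0n; ring.
Qed.

(* The size equation makes k the same for u, v as for v, u when u and v commute. *)
Lemma word_mx_mul u v :
  exists2 k, (size u + size v = size (word_mul u v) + k.*2)%N &
  word_mx u * word_mx v = (- 'X) ^+ k *: word_mx (word_mul u v).
Proof.
elim: u => [|a u [k sz E]] /=.
  by exists 0%N; rewrite ?addn0 // /word_mx big_nil mul1r scale1r.
rewrite {1}/word_mx big_cons -mulrA -/(word_mx u) E.
case: (word_mul u v) sz {E} => [|b w] /= sz.
  by exists k; [lia | rewrite -scalerAr /word_mx big_seq1 big_nil mulr1].
case: eqP => [->|_] /=.
  exists k.+1; first lia.
  rewrite -scalerAr /word_mx big_cons mulrA letter_mxV -/(word_mx w).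
  by rewrite [_ * _]mul_scalar_mx scalerA exprSr.
by exists k; [lia | rewrite -scalerAr /word_mx !big_cons].
Qed.

(** Modulo X the second column stays a multiple k of (1, c_a), the image of P_a. Prepending [a] to a
    word starting with [b] multiplies k by c_b - c_(a^-1), which is nonzero exactly because [b] is
    not the inverse of [a]. *)
Lemma word_mx_at0 a u : reduced (a :: u) ->
  exists2 k : int, k != 0 & (word_mx (a :: u) 0 1).[0] = k /\
     (word_mx (a :: u) 1 1).[0] = k * (letter_point a).[0].
Proof.
elim: u a => [|b u IHu] a /=.
  exists 1 => //; rewrite /word_mx big_seq1 !mxE /= !hornerE; split; ring.
move=> /andP[nba /IHu[k nzk [E0 E1]]].
exists (((letter_point b).[0] - (letter_point (letter_inv a)).[0]) * k).
  rewrite mulf_neq0 // subr_eq0; apply: contraNneq nba.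
  rewrite /letter_point -!polyC_natr !hornerE => E.
  case: b a E {E0 E1 IHu} => t s [t' s'] E; rewrite /letter_inv /=.
  have /= E' : ((pickle t).*2 + s)%N = ((pickle t').*2 + ~~ s')%N by move: E => /=; lia.
  have [/(pcan_inj pickleK) -> ->] : pickle t = pickle t' /\ s = ~~ s'.
    by case: s s' E' {E} => [] [] /=; lia.
  by [].
rewrite /word_mx big_cons -/(word_mx _) !mxE !big_ord_recl !big_ord0 !addr0.
rewrite (_ : lift _ _ = 1); last exact: val_inj.
rewrite !mxE /= !hornerE E0 E1; split; ring.
Qed.

Lemma word_mx_nonscalar u : reduced u -> u != [::] -> word_mx u 0 1 != 0.
Proof.
case: u => // a u /word_mx_at0[k nzk [E _]] _.
by apply: contraNneq nzk => Z; rewrite -E Z horner0.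
Qed.

Local Open Scope group_scope.

Lemma word_mx_commute (x y : free_group T) : commute x y ->
  (word_mx (fg_word x) * word_mx (fg_word y) =
   word_mx (fg_word y) * word_mx (fg_word x))%R.
Proof.
move=> /(congr1 (@fg_word T)) /= xy.
have [k szk ->] := word_mx_mul (fg_word x) (fg_word y).
have [l szl ->] := word_mx_mul (fg_word y) (fg_word x).
rewrite xy in szk *; congr (_ ^+ _ *: _)%R; lia.
Qed.

Lemma free_group_commute_trans (x y z : free_group T) :
  y != 1 -> commute y x -> commute y z -> commute x z.
Proof.
move=> ny yx yz.
have nzy : (word_mx (fg_word y) 0 1 != 0)%R.
  by apply: word_mx_nonscalar; [exact: valP | exact: ny].
(* Taking [x^-1] rather than [x] lets the two matrices of [x] and [x^-1] become adjacent and
   collapse to a scalar below. *)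
have := comm_mx2_trans nzy (word_mx_commute (commuteV yx)) (word_mx_commute yz).
pose W (g : free_group T) := word_mx (fg_word g).
rewrite -![word_mx (fg_word _)]/(W _) => xz.
have W1 : W 1 = 1%R by rewrite /W /word_mx big_nil.
have W_triv g : W g 0%R 1%R = 0%R -> g = 1.
  move=> Wg; apply/eqP; apply/idPn => ng.
  by have := word_mx_nonscalar (valP g) ng; rewrite -[word_mx _]/(W g) Wg eqxx.
have WM g h : exists k, (W g * W h = (- 'X) ^+ k *: W (g * h)%g)%R.
  by have [k _ E] := word_mx_mul (fg_word g) (fg_word h); exists k.
have [k Ek] := WM x^-1 z; have [l El] := WM x z^-1.
have [i Ei] := WM (x^-1 * z) (x * z^-1).
have [j Ej] := WM x^-1 x; have [p Ep] := WM z z^-1.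
(* W is multiplicative up to scalars, so W (x^-1 z x z^-1) is scalar. *)
have : ((W x^-1%g * W z) * (W x * W z^-1%g) =
        W z * (W x^-1%g * W x) * W z^-1%g)%R by rewrite xz !mulrA.
rewrite Ek El -scalerAl -scalerAr Ei Ej mulVg W1.
rewrite -scalerAr mulr1 -scalerAl Ep mulgV W1.
(* The right side is scalar and powers of - X are nonzero, so the commutator has zero (0,1) entry
   and is trivial. *)
move/matrixP/(_ 0%R 1%R); rewrite !mxE mulr0n !mulr0.
move/eqP; rewrite !mulf_eq0 !expf_eq0 oppr_eq0 polyX_eq0 !andbF /=.
move=> /eqP/W_triv xz1.
suff /commuteV : commute x z^-1 by rewrite invgK.
by apply: (mulgI (x^-1 * z)); rewrite xz1 mulgA mulgK mulVg.
Qed.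
End FreeGroupRepresentation.


(** * Maps out of direct products, and comparison of ranks *)

Local Open Scope group_scope.

Lemma free_group_not_commute (T : choiceType) (s t : T) :
  s != t -> ~ commute (fg_gen s) (fg_gen t).
Proof.
move=> nst /(congr1 (@fg_word T)) /=; rewrite /letter_inv /= !xpair_eqE !andbF.
by case=> st _; rewrite st eqxx in nst.
Qed.

Lemma pair1_commute (G H : groupType) (x : G) (y : H) :
  commute (x, 1) (1, y).
Proof. by congr (_, _); rewrite /= ?mulg1 ?mul1g. Qed.

Lemma pair_mul1 (G H : groupType) (x : G) (y : H) :
  (x, y) = (x, 1) * (1, y).
Proof. by congr (_, _); rewrite /= ?mulg1 ?mul1g. Qed.

(** If the image of one factor is not abelian, a nontrivial image of an element of the other would
    commute with all of it, against transitivity. If both images are abelian, so is [K], against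
    [ngh]. *)
Lemma pair_surj_factor_trivial (G H K : groupType)
    (f : {multiplicative (G * H)%type -> K}) (g h : K) :
  (forall x y z : K, y != 1 -> commute y x -> commute y z -> commute x z) ->
  ~ commute g h -> (forall k, exists u, f u = k) ->
  (forall x, f (x, 1) = 1) \/ (forall y, f (1, y) = 1).
Proof.
move=> ct ngh surj.
have ab x y : commute (f (x, 1)) (f (1, y)) by apply/gmulf_commute/pair1_commute.
have [[a1 b1] Eg] := surj g; have [[a2 b2] Eh] := surj h.
have [aa|/eqP naa] :=
  eqVneq (f (a1, 1) * f (a2, 1)) (f (a2, 1) * f (a1, 1)); last first.
  right=> b; have [//|nb] := eqVneq (f (1, b)) 1.
  by case: naa; apply: (ct _ _ _ nb); apply/commute_sym/ab.
have [bb|/eqP nbb] :=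
  eqVneq (f (1, b1) * f (1, b2)) (f (1, b2) * f (1, b1)); last first.
  left=> a; have [//|na] := eqVneq (f (a, 1)) 1.
  by case: nbb; apply: (ct _ _ _ na); apply: ab.
case: ngh; rewrite -Eg -Eh [(a1, _)]pair_mul1 [(a2, _)]pair_mul1 !gmulfM.
by apply: commuteM; apply/commute_sym/commuteM => //; apply/commute_sym => //;
   apply: ab.
Qed.

(** Count homomorphisms to the finite group [{perm bool}], encoded by their values on generators:
    precomposition with a surjection is injective. *)
Lemma free_surj_rank n m (phi : {multiplicative free n -> free m}) :
  (forall y, exists x, phi x = y) -> m <= n.
Proof.
move=> surj.
pose Phi (h : {ffun 'I_m -> {perm bool}}) :=
  [ffun i : 'I_n => fg_lift h (phi (fg_gen i))].
have Phi_inj : injective Phi.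
  move=> h h' /ffunP Phihh'; apply/ffunP=> j.
  rewrite -[h j]fg_lift_gen -[h' j]fg_lift_gen.
  have [x <-] := surj (fg_gen j).
  pose c i := fg_lift h (phi (fg_gen i)).
  rewrite [LHS](@fg_lift_unique _ _ c (fg_lift h \o phi)) //; last exact: gmulfM.
  rewrite [RHS](@fg_lift_unique _ _ c (fg_lift h' \o phi)) //; first exact: gmulfM.
  by move=> i; have := Phihh' i; rewrite !ffunE.
have := leq_card _ Phi_inj.
rewrite !card_ffun !card_ord leq_exp2l //; apply/card_gt1P.
exists 1, (tperm true false); split=> //.
by apply/eqP => /permP/(_ true); rewrite tpermL perm1.
Qed.

Lemma bijective_pair (A B A' B' : Type) (f : A * B -> A' * B')
    (phi : A -> A') (psi : B -> B') (a0 : A) (b0 : B) :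
  (forall x y, f (x, y) = (phi x, psi y)) ->
  bijective f -> bijective phi /\ bijective psi.
Proof.
move=> fE [g fK gK]; split.
  (* The inverse of [phi] is read off [g] on the slice through [psi b0]. *)
  exists (fun x => (g (x, psi b0)).1) => x; first by rewrite -fE fK.
  by have := gK (x, psi b0); case: (g _) => a b; rewrite fE => -[].
exists (fun y => (g (phi a0, y)).2) => y; first by rewrite -fE fK.
by have := gK (phi a0, y); case: (g _) => a b; rewrite fE => -[].
Qed.

Lemma pair_bijective (A B A' B' : Type) (f : A * B -> A' * B')
    (phi : A -> A') (psi : B -> B') :
  (forall x y, f (x, y) = (phi x, psi y)) ->
  bijective phi -> bijective psi -> bijective f.
Proof.
move=> fE [phi' phiK phiK'] [psi' psiK psiK'].
exists (fun u => (phi' u.1, psi' u.2)) => -[x y]; first by rewrite fE /= phiK psiK.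
by rewrite fE phiK' psiK'.
Qed.

Definition swap_pair (A B : Type) (u : A * B) : B * A := (u.2, u.1).

Lemma swap_pair_bij (A B : Type) : bijective (@swap_pair A B).
Proof. by exists (@swap_pair B A) => -[]. Qed.

(** Named embeddings can carry a morphism structure, so that the component mappings of [f] are
    bundled homomorphisms by composition. *)
Definition pair1r (G H : groupType) (x : G) : G * H := (x, 1).
Definition pair1l (G H : groupType) (y : H) : G * H := (1, y).

Fact pair1r_morph (G H : groupType) : {morph @pair1r G H : x y / x * y}.
Proof. by move=> x y; congr (_, _); rewrite /= mulg1. Qed.
Fact pair1l_morph (G H : groupType) : {morph @pair1l G H : x y / x * y}.
Proof. by move=> x y; congr (_, _); rewrite /= mulg1. Qed.

HB.instance Definition _ (G H : groupType) :=
  isMultiplicative.Build G (G * H)%type (@pair1r G H) (@pair1r_morph G H).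
HB.instance Definition _ (G H : groupType) :=
  isMultiplicative.Build H (G * H)%type (@pair1l G H) (@pair1l_morph G H).

Lemma free_cast_comp_automorphism n m (e : n = m)
    (phi : {multiplicative free n -> free m}) :
  bijective phi -> is_automorphism (free_cast (esym e) \o phi).
Proof. by case: m / e phi => phi bphi; split; [exact: gmulfM|]. Qed.

Lemma comp_free_cast_automorphism n m (e : n = m)
    (psi : {multiplicative free m -> free n}) :
  bijective psi -> is_automorphism (psi \o free_cast e).
Proof. by case: m / e psi => psi bpsi; split; [exact: gmulfM|]. Qed.

Theorem corollary3p3 (n m : nat) (hn : 2 <= n) (hm : 2 <= m)
    (f : {multiplicative (free n * free m)%type -> (free n * free m)%type}) :
  is_automorphism f <->
  (exists (phi : {multiplicative free n -> free n})
          (psi : {multiplicative free m -> free m}),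
      [/\ type_VI_with f phi psi, is_automorphism phi & is_automorphism psi])
  \/
  (exists (e : n = m)
          (phi : {multiplicative free n -> free m})
          (psi : {multiplicative free m -> free n}),
      [/\ type_VII_with f phi psi,
          is_automorphism (free_cast (esym e) \o phi)
        & is_automorphism (psi \o free_cast e)]).
Proof.
split; last first.
  case=> [[phi [psi [fE [_ bphi] [_ bpsi]]]]|[e]].
    by split; [exact: gmulfM | exact: pair_bijective fE bphi bpsi].
  case: m / e f {hm} => f [phi [psi [fE [_ bphi] [_ bpsi]]]].
  split; first exact: gmulfM.
  (* Swapping the coordinates of the output reduces type VII to a componentwise map. *)
  have bsf : bijective (@swap_pair _ _ \o f).
    by apply: pair_bijective bphi bpsi => x y; rewrite /= fE.
  apply: (eq_bij (bij_comp (@swap_pair_bij _ _) bsf)) => u /=.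
  by case: (f u).
case=> _ bf; have [f' fK f'K] := bf.
have fE x y : f (x, y) = f (x, 1) * f (1, y) by rewrite -gmulfM -pair_mul1.
have noncomm k (hk : 2 <= k) : exists g h : free k, ~ commute g h.
  exists (fg_gen (Ordinal (ltnW hk))), (fg_gen (Ordinal hk)).
  exact: free_group_not_commute.
have nontriv k (hk : 2 <= k) : exists g : free k, g != 1.
  by exists (fg_gen (Ordinal hk)).
have [g1 [g2 ncg]] := noncomm n hn; have [h1 [h2 nch]] := noncomm m hm.
(* Each coordinate of [f] is onto a nonabelian free group, hence kills one of the two factors. *)
have D1 := @pair_surj_factor_trivial _ _ _ (fst \o f) g1 g2
  (@free_group_commute_trans 'I_n) ncg.
have D2 := @pair_surj_factor_trivial _ _ _ (snd \o f) h1 h2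
  (@free_group_commute_trans 'I_m) nch.
have f1 : f 1 = 1 by apply: (mulgI (f 1)); rewrite -gmulfM !mulg1.
have {D1} D1 : (forall x, (f (x, 1)).1 = 1) \/ (forall y, (f (1, y)).1 = 1).
  by apply: D1 => k; exists (f' (k, 1)); rewrite /= f'K.
have {D2} D2 : (forall x, (f (x, 1)).2 = 1) \/ (forall y, (f (1, y)).2 = 1).
  by apply: D2 => k; exists (f' (1, k)); rewrite /= f'K.
have injl : ~ forall x, f (x, 1) = 1.
  have [g /eqP ng] := nontriv n hn; move=> /(_ g); rewrite -[RHS]f1.
  by move=> /(can_inj fK) [].
have injr : ~ forall y, f (1, y) = 1.
  have [g /eqP ng] := nontriv m hm; move=> /(_ g); rewrite -[RHS]f1.
  by move=> /(can_inj fK) [].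
(* If both coordinates kill the same factor, [f] is not injective; the mixed cases are types VII and
   VI. *)
case: D1 D2 => [A1|B1] [A2|B2].
- by case: injl => x; rewrite [LHS]surjective_pairing A1 A2.
- right.
  pose phi : {multiplicative free n -> free m} := snd \o f \o @pair1r _ _.
  pose psi : {multiplicative free m -> free n} := fst \o f \o @pair1l _ _.
  have VII : type_VII_with f phi psi.
    by move=> x y; rewrite fE [LHS]surjective_pairing /= A1 B2 mul1g mulg1.
  have [bphi bpsi] : bijective phi /\ bijective psi.
    apply: (@bijective_pair _ _ _ _ (@swap_pair _ _ \o f) phi psi 1 1).
      by move=> x y; rewrite /= VII.
    exact: bij_comp (@swap_pair_bij _ _) bf.
  have e : n = m.
    apply/eqP; rewrite eqn_leq.
    rewrite (@free_surj_rank _ _ phi) ?(@free_surj_rank _ _ psi) //.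
      by case: bpsi => p _ pK y; exists (p y).
    by case: bphi => p _ pK y; exists (p y).
  exists e, phi, psi; split=> //. exact: free_cast_comp_automorphism.
  exact: comp_free_cast_automorphism.
- left.
  pose phi : {multiplicative free n -> free n} := fst \o f \o @pair1r _ _.
  pose psi : {multiplicative free m -> free m} := snd \o f \o @pair1l _ _.
  have VI : type_VI_with f phi psi.
    by move=> x y; rewrite fE [LHS]surjective_pairing /= A2 B1 mul1g mulg1.
  have [bphi bpsi] := bijective_pair 1 1 VI bf.
  by exists phi, psi; split=> //; split=> //; exact: gmulfM.
- by case: injr => y; rewrite [LHS]surjective_pairing B1 B2.
Qed.
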